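(* Let $\mathcal{E}$ be a globally generated vector bundle of rank $r$ on $Q$ with $c_1(\mathcal{E})=(a,0)$. If $r>2$, assume moreover that $a\le 2$. Then $$\mathcal{E}\cong\bigoplus_{i=1}^r\mathcal{O}_Q(a_i,0),$$ where the $a_i$ are nonnegative integers whose sum is $a$. Similarly, if $c_1(\mathcal{E})=(0,b)$ (with $b\le 2$ if $r>2$), then $\mathcal{E}\cong\bigoplus_{i=1}^r\mathcal{O}_Q(0,b_i)$ with $b_i$ nonnegative integers whose sum is $b$.
   Context: The base field is $\mathbb{C}$. $Q\cong\mathbb{P}^1\times\mathbb{P}^1$ is a smooth quadric surface, with projections $f,g$ to the two factors, and $\mathcal{O}_Q(a,b)=f^*\mathcal{O}_{\mathbb{P}^1}(a)\otimes g^*\mathcal{O}_{\mathbb{P}^1}(b)$. A vector bundle $\mathcal{E}$ has $c_1(\mathcal{E})=(a,b)\in\mathbb{Z}^{2}$ if $\det\mathcal{E}\cong\mathcal{O}_Q(a,b)$. *)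

(* Defs.v *)
From mathcomp Require Import all_boot all_order all_algebra.
From mathcomp Require Import classical_sets reals.
From mathcomp Require Export complex mxtens.

Set Implicit Arguments.
Unset Strict Implicit.
Unset Printing Implicit Defensive.

Import GRing.Theory.
Local Open Scope classical_set_scope.
Local Open Scope ring_scope.

(* Varieties are classical ones: sets of closed points with the Zariski       *)
(* topology and K-valued regular functions.                                   *)

Definition P1 (K : fieldType) : Type :=
  {L : {vspace 'rV[K]_2} | \dim L == 1%N}.

(* Homogeneous coordinates of a point of P1, i.e. the entries of a chosen     *)
(* nonzero vector of the line.  They are only used in expressions that do not *)
(* depend on that choice: vanishing of forms and quotients of forms of the    *)
(* same degree.                                                               *)
Definition hcoord (K : fieldType) (p : P1 K) (i : 'I_2) : K :=
  vpick (val p) 0 i.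

Definition quadric (K : fieldType) : Type := (P1 K * P1 K)%type.

Section Quadric.

Variable K : fieldType.
Local Notation Q := (quadric K).

(* The bihomogeneous form of bidegree (m, n) with coefficients F:             *)
(* \sum_(i, j) F i j x_0^i x_1^(m-i) y_0^j y_1^(n-j).                         *)
Definition biform (m n : nat) := 'M[K]_(m.+1, n.+1).

Definition bieval (m n : nat) (F : biform m n) (p : Q) : K :=
  \sum_(i < m.+1) \sum_(j < n.+1)
    F i j * (hcoord p.1 ord0 ^+ i * hcoord p.1 ord_max ^+ (m - i))
          * (hcoord p.2 ord0 ^+ j * hcoord p.2 ord_max ^+ (n - j)).

(* U is a union of basic open sets {G <> 0}, i.e. its complement is the       *)
(* common zero locus of a family of bihomogeneous forms.                      *)
Definition zariski_open (U : set Q) : Prop :=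
  forall p, U p -> exists (m n : nat) (G : biform m n),
    bieval G p != 0 /\ [set q | bieval G q != 0] `<=` U.

Definition regular_on (U : set Q) (f : Q -> K) : Prop :=
  forall p, U p ->
  exists V : set Q, [/\ zariski_open V, V p, V `<=` U &
    exists (m n : nat) (F G : biform m n),
      forall q, V q -> bieval G q != 0 /\ f q = bieval F q / bieval G q].

Definition regular_mx (U : set Q) (r s : nat) (A : Q -> 'M[K]_(r, s)) : Prop :=
  forall i j, regular_on U (fun q => A q i j).

End Quadric.

(* Vector bundles are given by trivializing covers and transition matrices.   *)
(* A section is a family of column vectors s_i over dom i such that           *)
(* s_i = trans i j *m s_j on the overlaps; the values of trans i j outside    *)
(* dom i `&` dom j are irrelevant.                                            *)
Record cocycle (K : fieldType) (X : Type) (r : nat) := Cocycle {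
  idx : Type;
  dom : idx -> set X;
  trans : idx -> idx -> X -> 'M[K]_r }.

Section Constructions.

Variable K : fieldType.

Definition pullback (X Y : Type) (r : nat) (f : X -> Y) (E : cocycle K Y r) :
    cocycle K X r :=
  @Cocycle K X r (idx E) (fun i => f @^-1` dom i)
    (fun i j x => trans i j (f x)).

Definition tensor (X : Type) (r s : nat) (E : cocycle K X r)
    (F : cocycle K X s) : cocycle K X (r * s) :=
  @Cocycle K X (r * s) (idx E * idx F)%type
    (fun i => dom i.1 `&` dom i.2)
    (fun i j x => trans i.1 j.1 x *t trans i.2 j.2 x).

Definition determinant (X : Type) (r : nat) (E : cocycle K X r) :
    cocycle K X 1 :=
  @Cocycle K X 1 (idx E) (fun i => dom i)
    (fun i j x => (\det (trans i j x))%:M).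

Definition line_sum (X : Type) (r : nat) (L : 'I_r -> cocycle K X 1) :
    cocycle K X r :=
  @Cocycle K X r (forall k, idx (L k))
    (fun i => [set x | forall k, dom (i k) x])
    (fun i j x => diag_mx (\row_k trans (i k) (j k) x 0 0)).

(* A form P of degree a gives the section P / x_i ^ a over {x_i <> 0}.        *)
Definition O_P1 (a : int) : cocycle K (P1 K) 1 :=
  @Cocycle K (P1 K) 1 'I_2 (fun i => [set p | hcoord p i != 0])
    (fun i j p => ((hcoord p j / hcoord p i) ^ a)%:M).

Definition O_Q (a b : int) : cocycle K (quadric K) 1 :=
  tensor (pullback fst (O_P1 a)) (pullback snd (O_P1 b)).

End Constructions.

Section BundlesOnQuadric.

Variable K : fieldType.
Local Notation Q := (quadric K).

(* trans i j takes invertible values on the overlap, with inverse trans j i,  *)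
(* by the last two conditions.                                                *)
Definition vector_bundle (r : nat) (E : cocycle K Q r) : Prop :=
  [/\ forall p, exists i : idx E, dom i p,
      forall i : idx E, zariski_open (dom i),
      forall i j : idx E, regular_mx (dom i `&` dom j) (trans i j),
      forall (i : idx E) p, dom i p -> trans i i p = 1%:M &
      forall (i j k : idx E) p, dom i p -> dom j p -> dom k p ->
        trans i j p *m trans j k p = trans i k p].

Definition bundle_morphism (r s : nat) (E : cocycle K Q r) (F : cocycle K Q s)
    (h : idx F -> idx E -> Q -> 'M[K]_(s, r)) : Prop :=
  (forall j i, regular_mx (dom j `&` dom i) (h j i)) /\
  (forall j j' i i' p, dom j p -> dom j' p -> dom i p -> dom i' p ->
     h j i p = trans j j' p *m h j' i' p *m trans i' i p).

Definition bundle_iso (r : nat) (E F : cocycle K Q r) : Prop :=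
  exists (h : idx F -> idx E -> Q -> 'M[K]_r)
         (k : idx E -> idx F -> Q -> 'M[K]_r),
    [/\ bundle_morphism h, bundle_morphism k &
        forall j i p, dom j p -> dom i p ->
          h j i p *m k i j p = 1%:M /\ k i j p *m h j i p = 1%:M].

Definition global_section (r : nat) (E : cocycle K Q r)
    (s : idx E -> Q -> 'cV[K]_r) : Prop :=
  (forall i, regular_mx (dom i) (s i)) /\
  (forall i j p, dom i p -> dom j p -> s i p = trans i j p *m s j p).

(* The evaluation map from global sections to each fibre is onto.             *)
Definition globally_generated (r : nat) (E : cocycle K Q r) : Prop :=
  forall (i : idx E) (p : Q), dom i p -> forall v : 'cV[K]_r,
    exists s, global_section s /\ s i p = v.

Definition has_c1 (r : nat) (E : cocycle K Q r) (a b : int) : Prop :=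
  bundle_iso (determinant E) (O_Q K a b).

End BundlesOnQuadric.

(* Main.v *)
Require Import Defs.
From mathcomp Require Import all_boot all_order all_algebra.
From mathcomp Require Import boolp classical_sets reals ring zify.

Set Implicit Arguments.
Unset Strict Implicit.
Unset Printing Implicit Defensive.

Import GRing.Theory.
Local Open Scope classical_set_scope.
Local Open Scope ring_scope.

(** E is globally generated and its determinant is constant along each ruling
   {x} x P^1, so r global sections that are independent at one point of the
   ruling are independent along all of it.  Hence E is trivial along the
   rulings and comes from the first factor, where it splits like any bundle on
   a projective line.  The argument below does both at once.

   A bundle map O(a_1, 0) + ... + O(a_r, 0) -> E is a matrix Phi of local
   columns, the k-th of which is homogeneous of degree - a_k in the first
   variable x ([twisted]).  Composing det Phi with the isomorphism
   det E = O(a, 0) gives a section of O(a - sum a_k, 0), and such a section is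
   a form in x alone ([section_xform], [twisted_det]).  This rests on the
   description of the sections of O(d) on the projective line ([P1_section]),
   which comes down to the fact that a function on the affine line that is
   locally a quotient of polynomials is a polynomial
   ([locally_rational_poly]).

   Start with all a_k = 0 and r global sections that form a basis at some
   point.  While the determinant, a form of degree d = a - sum a_k, is not
   constant, it vanishes along a ruling {x0} x P^1, and at a point there a
   nontrivial combination of the columns vanishes.  Among the columns that
   occur in it, take one of least degree a_k: multiplying the others by forms
   of degree a_j - a_k makes the combination homogeneous.  It vanishes along
   the whole ruling, so it can be divided by the equation of x0 and replace the
   k-th column; a_k grows by 1 and d drops by 1 ([elementary_modification]).
   When d = 0 the determinant is a nonzero constant and Phi is an isomorphism
   ([everywhere_frame], [frame_iso]).

   The degrees a_k start at 0 and only grow, so they are nonnegative.  The case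
   of c_1 = (0, b) follows by exchanging the two factors. *)

(** * Bihomogeneous forms and regular functions on the quadric *)

Section Forms.

Variable K : fieldType.
Local Notation Q := (quadric K).

Definition bihom (m n : nat) (g : Q -> K) : Prop :=
  exists F : biform K m n, forall q, g q = bieval F q.

Definition monomial (i k j l : nat) (q : Q) : K :=
  (hcoord q.1 ord0 ^+ i * hcoord q.1 ord_max ^+ k)
  * (hcoord q.2 ord0 ^+ j * hcoord q.2 ord_max ^+ l).

Lemma eq_bihom m n (g h : Q -> K) : g =1 h -> bihom m n g -> bihom m n h.
Proof. by move=> gh [F Fg]; exists F => q; rewrite -gh. Qed.

Lemma bihom0 m n : bihom m n (fun=> 0).
Proof.
exists 0 => q; rewrite /bieval; apply/esym/big1 => i _; apply: big1 => j _.
by rewrite mxE !mul0r.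
Qed.

Lemma bihomD m n (g h : Q -> K) :
  bihom m n g -> bihom m n h -> bihom m n (fun q => g q + h q).
Proof.
move=> [F Fg] [G Gh]; exists (F + G) => q; rewrite Fg Gh /bieval -big_split.
apply: eq_bigr => i _; rewrite -big_split; apply: eq_bigr => j _.
by rewrite mxE !mulrDl.
Qed.

Lemma bihomZ m n c (g : Q -> K) : bihom m n g -> bihom m n (fun q => c * g q).
Proof.
move=> [F Fg]; exists (c *: F) => q; rewrite Fg /bieval mulr_sumr.
apply: eq_bigr => i _; rewrite mulr_sumr; apply: eq_bigr => j _.
by rewrite mxE !mulrA.
Qed.

Lemma bihom_sum m n (I : Type) (r : seq I) (P : pred I) (g : I -> Q -> K) :
  (forall i, P i -> bihom m n (g i)) ->
  bihom m n (fun q => \sum_(i <- r | P i) g i q).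
Proof.
move=> gP; elim: r => [|i r IHr].
  by apply: eq_bihom (bihom0 m n) => q; rewrite big_nil.
have [Pi|nPi] := boolP (P i).
  by apply: eq_bihom (bihomD (gP i Pi) IHr) => q; rewrite big_cons Pi.
by apply: eq_bihom IHr => q; rewrite big_cons (negPf nPi).
Qed.

Lemma bihom_monomial i k j l : bihom (i + k) (j + l) (monomial i k j l).
Proof.
have le_i : (i < (i + k).+1)%N by rewrite ltnS leq_addr.
have le_j : (j < (j + l).+1)%N by rewrite ltnS leq_addr.
exists (delta_mx (Ordinal le_i) (Ordinal le_j)) => q.
rewrite /bieval (bigD1 (Ordinal le_i)) //= (bigD1 (Ordinal le_j)) //=.
rewrite mxE !eqxx mul1r !addKn big1 ?addr0; last first.
  by move=> j' /negPf ne_j; rewrite mxE ne_j andbF !mul0r.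
rewrite big1 ?addr0 // => i' /negPf ne_i.
by apply: big1 => j' _; rewrite mxE ne_i !mul0r.
Qed.

Lemma bieval_monomial m n (F : biform K m n) q :
  bieval F q = \sum_(i < m.+1) \sum_(j < n.+1)
     F i j * monomial i (m - i) j (n - j) q.
Proof.
by apply: eq_bigr => i _; apply: eq_bigr => j _; rewrite /monomial !mulrA.
Qed.

Lemma bihomM m n m' n' (g h : Q -> K) :
  bihom m n g -> bihom m' n' h -> bihom (m + m') (n + n') (fun q => g q * h q).
Proof.
move=> [F Fg] [G Gh].
have mono_h i k j l : bihom (i + k + m') (j + l + n')
    (fun q => monomial i k j l q * h q).
  apply: (@eq_bihom _ _ (fun q => \sum_(i' < m'.+1) \sum_(j' < n'.+1)
     G i' j' * monomial (i + i') (k + (m' - i')) (j + j') (l + (n' - j')) q)).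
    move=> q; rewrite Gh bieval_monomial mulr_sumr; apply: eq_bigr => i' _.
    rewrite mulr_sumr; apply: eq_bigr => j' _.
    rewrite /monomial !exprD.
    move: (_ ^+ i) (_ ^+ i') (_ ^+ k) (_ ^+ (m' - i')).
    move: (_ ^+ j) (_ ^+ j') (_ ^+ l) (_ ^+ (n' - j')) => *.
    by ring.
  apply: bihom_sum => i' _; apply: bihom_sum => j' _; apply: bihomZ.
  have -> : (i + k + m' = (i + i') + (k + (m' - i')))%N.
    by rewrite addnACA subnKC // -ltnS.
  have -> : (j + l + n' = (j + j') + (l + (n' - j')))%N.
    by rewrite addnACA subnKC // -ltnS.
  exact: bihom_monomial.
apply: (@eq_bihom _ _ (fun q => \sum_(i < m.+1) \sum_(j < n.+1)
   F i j * (monomial i (m - i) j (n - j) q * h q))).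
  move=> q; rewrite Fg bieval_monomial mulr_suml; apply: eq_bigr => i _.
  by rewrite mulr_suml; apply: eq_bigr => j _; rewrite mulrA.
apply: bihom_sum => i _; apply: bihom_sum => j _; apply: bihomZ.
have := mono_h i (m - i)%N j (n - j)%N.
by rewrite !subnKC // -ltnS.
Qed.

Lemma bihom_const c : bihom 0 0 (fun=> c).
Proof.
apply: eq_bihom (bihomZ c (bihom_monomial 0 0 0 0)) => q.
by rewrite /monomial !expr0 !mulr1.
Qed.

Lemma bihom_x c : bihom 1 0 (fun q => hcoord q.1 c).
Proof.
case: (unliftP ord0 c) => [c'|] ->.
  apply: eq_bihom (bihom_monomial 0 1 0 0) => q.
  rewrite /monomial !expr0 expr1 mul1r !mulr1; congr (hcoord _ _).
  by apply: val_inj; rewrite /= ord1.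
apply: eq_bihom (bihom_monomial 1 0 0 0) => q.
by rewrite /monomial !expr0 expr1 !mulr1.
Qed.

Lemma bihom_y c : bihom 0 1 (fun q => hcoord q.2 c).
Proof.
case: (unliftP ord0 c) => [c'|] ->.
  apply: eq_bihom (bihom_monomial 0 0 0 1) => q.
  rewrite /monomial !expr0 expr1 !mul1r; congr (hcoord _ _).
  by apply: val_inj; rewrite /= ord1.
apply: eq_bihom (bihom_monomial 0 0 1 0) => q.
by rewrite /monomial !expr0 expr1 !mulr1 mul1r.
Qed.

Lemma bihomX m n (g : Q -> K) k :
  bihom m n g -> bihom (k * m) (k * n) (fun q => g q ^+ k).
Proof.
move=> gP; elim: k => [|k IHk].
  by apply: eq_bihom (bihom_const 1) => q; rewrite expr0.
by rewrite !mulSn; apply: eq_bihom (bihomM gP IHk) => q; rewrite exprS.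
Qed.

Lemma zariski_openP (U : set Q) : zariski_open U <->
  forall p, U p -> exists m n (G : Q -> K),
    [/\ bihom m n G, G p != 0 & forall q, G q != 0 -> U q].
Proof.
split=> Uopen p /Uopen [m [n [G]]].
  by case=> Gp GU; exists m, n, (bieval G); split=> //; exists G.
move=> [[F FG] Gp GU]; exists m, n, F; split; first by rewrite -FG.
by move=> q /=; rewrite -FG; apply: GU.
Qed.

Lemma zariski_openI (U V : set Q) :
  zariski_open U -> zariski_open V -> zariski_open (U `&` V).
Proof.
move=> /zariski_openP Uo /zariski_openP Vo; apply/zariski_openP => p [Up Vp].
have [m [n [G [GP Gp GU]]]] := Uo _ Up.
have [m' [n' [H [HP Hp HV]]]] := Vo _ Vp.
exists (m + m')%N, (n + n')%N, (fun q => G q * H q); split.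
- exact: bihomM.
- by rewrite mulf_neq0.
by move=> q; rewrite mulf_eq0 negb_or => /andP[/GU ? /HV ?].
Qed.

Lemma zariski_open_bihom m n (G : Q -> K) :
  bihom m n G -> zariski_open [set q | G q != 0].
Proof. by move=> GP; apply/zariski_openP => p Gp; exists m, n, G; split. Qed.

(** If f = F / G on a neighbourhood V of p, multiplying by a form H with
   p in {H <> 0} and {H <> 0} inside V gives f * (G * H) = F * H, which holds at
   every point of the surface.  In this shape sums, products, inverses and
   restrictions to rulings need no bookkeeping of domains. *)
Lemma regular_onP (U : set Q) (f : Q -> K) : regular_on U f <->
  forall p, U p -> exists m n (P G : Q -> K), [/\ bihom m n P, bihom m n G,
    G p != 0, forall q, G q != 0 -> U q & forall q, f q * G q = P q].
Proof.
split=> Ureg p /Ureg.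
  case=> V [/zariski_openP Vo Vp VU [m [n [F [G FG]]]]].
  have [m' [n' [H [HP Hp HV]]]] := Vo _ Vp.
  exists (m + m')%N, (n + n')%N, (fun q => bieval F q * H q),
    (fun q => bieval G q * H q); split.
  - by apply: bihomM => //; exists F.
  - by apply: bihomM => //; exists G.
  - by rewrite mulf_neq0 //; case: (FG _ Vp).
  - by move=> q; rewrite mulf_eq0 negb_or => /andP[_ /HV /VU].
  move=> q; have [->|Hq] := eqVneq (H q) 0; first by rewrite !mulr0.
  by have [Gq ->] := FG _ (HV _ Hq); rewrite mulrA divfK.
case=> m [n [P [G [[F FP] [H HG] Gp GU fG]]]].
exists [set q | G q != 0]; split=> //.
  by apply: (@zariski_open_bihom m n); exists H.
by exists m, n, F, H => q /= Gq; rewrite -HG -FP -fG mulfK.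
Qed.

Lemma regular_local (U : set Q) (f : Q -> K) :
  (forall p, U p -> exists V g, [/\ V p, V `<=` U, regular_on V g &
     forall q, V q -> f q = g q]) -> regular_on U f.
Proof.
move=> loc; apply/regular_onP => p /loc [V [g [Vp VU /regular_onP greg fg]]].
have [m [n [P [G [PP GP Gp GV gG]]]]] := greg _ Vp.
exists m, n, P, G; split=> // [q /GV /VU //|q].
have [Gq|Gq] := eqVneq (G q) 0; first by rewrite -gG Gq !mulr0.
by rewrite fg ?gG //; apply: GV.
Qed.

Lemma regular_sub (U V : set Q) (f : Q -> K) :
  zariski_open V -> V `<=` U -> regular_on U f -> regular_on V f.
Proof.
move=> /zariski_openP Vo VU /regular_onP freg; apply/regular_onP => p Vp.
have [m [n [P [G [PP GP Gp GU fG]]]]] := freg _ (VU _ Vp).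
have [m' [n' [H [HP Hp HV]]]] := Vo _ Vp.
exists (m + m')%N, (n + n')%N, (fun q => P q * H q), (fun q => G q * H q).
split; rewrite ?mulf_neq0 //; try exact: bihomM.
  by move=> q; rewrite mulf_eq0 negb_or => /andP[_ /HV].
by move=> q; rewrite mulrA fG.
Qed.

Lemma eq_regular (U : set Q) (f g : Q -> K) :
  (forall q, U q -> f q = g q) -> regular_on U f -> regular_on U g.
Proof.
by move=> fg freg; apply: regular_local => p Up; exists U, f; split=> // q /fg.
Qed.

Lemma regular_ratio (U : set Q) m n (F G : Q -> K) : zariski_open U ->
  (forall q, U q -> G q != 0) -> bihom m n F -> bihom m n G ->
  regular_on U (fun q => F q / G q).
Proof.
move=> Uo UG FP GP; apply: (@regular_sub [set q | G q != 0]) => //.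
apply/regular_onP => p Gp.
exists (m + m)%N, (n + n)%N, (fun q => F q * G q), (fun q => G q * G q).
split; rewrite ?mulf_neq0 //; try exact: bihomM.
  by move=> q; rewrite mulf_eq0 negb_or => /andP[].
move=> q; have [->|Gq] := eqVneq (G q) 0; first by rewrite !mulr0.
by rewrite mulrA divfK.
Qed.

Lemma regular_const (U : set Q) c : zariski_open U -> regular_on U (fun=> c).
Proof.
move=> Uo.
have := @regular_ratio U 0 0 (fun=> c) (fun=> 1) Uo _
  (bihom_const _) (bihom_const _).
by rewrite divr1; apply=> q _; rewrite oner_eq0.
Qed.

Lemma regularD (U : set Q) (f g : Q -> K) : regular_on U f -> regular_on U g ->
  regular_on U (fun q => f q + g q).
Proof.
move=> /regular_onP freg /regular_onP greg; apply/regular_onP => p Up.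
have [m [n [P [G [PP GP Gp GU fG]]]]] := freg _ Up.
have [m' [n' [P' [G' [PP' GP' Gp' GU' gG]]]]] := greg _ Up.
exists (m + m')%N, (n + n')%N, (fun q => P q * G' q + G q * P' q),
  (fun q => G q * G' q); split; rewrite ?mulf_neq0 //; try exact: bihomM.
- by apply: bihomD; apply: bihomM.
- by move=> q; rewrite mulf_eq0 negb_or => /andP[/GU].
by move=> q; rewrite -fG -gG; ring.
Qed.

Lemma regularM (U : set Q) (f g : Q -> K) : regular_on U f -> regular_on U g ->
  regular_on U (fun q => f q * g q).
Proof.
move=> /regular_onP freg /regular_onP greg; apply/regular_onP => p Up.
have [m [n [P [G [PP GP Gp GU fG]]]]] := freg _ Up.
have [m' [n' [P' [G' [PP' GP' Gp' GU' gG]]]]] := greg _ Up.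
exists (m + m')%N, (n + n')%N, (fun q => P q * P' q),
  (fun q => G q * G' q); split; rewrite ?mulf_neq0 //; try exact: bihomM.
- by move=> q; rewrite mulf_eq0 negb_or => /andP[/GU].
by move=> q; rewrite -fG -gG; ring.
Qed.

Lemma regularV (U : set Q) (f : Q -> K) : (forall q, U q -> f q != 0) ->
  regular_on U f -> regular_on U (fun q => (f q)^-1).
Proof.
move=> f_neq0 /regular_onP freg; apply/regular_onP => p Up.
have [m [n [P [G [PP GP Gp GU fG]]]]] := freg _ Up.
exists m, n, G, P; split=> //.
- by rewrite -fG mulf_neq0 ?f_neq0.
- by move=> q; rewrite -fG mulf_eq0 negb_or => /andP[_ /GU].
move=> q; have [Gq|Gq] := eqVneq (G q) 0; first by rewrite -fG Gq !mulr0.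
by rewrite -fG mulKf // f_neq0 //; apply: GU.
Qed.

Lemma regular_sum (U : set Q) (I : Type) (r : seq I) (P : pred I)
    (f : I -> Q -> K) :
  zariski_open U -> (forall i, P i -> regular_on U (f i)) ->
  regular_on U (fun q => \sum_(i <- r | P i) f i q).
Proof.
move=> Uo freg; elim: r => [|i r IHr].
  by apply: eq_regular (regular_const 0 Uo) => q _; rewrite big_nil.
have [Pi|nPi] := boolP (P i).
  by apply: eq_regular (regularD (freg i Pi) IHr) => q _; rewrite big_cons Pi.
by apply: eq_regular IHr => q _; rewrite big_cons (negPf nPi).
Qed.

Lemma regular_prod (U : set Q) (I : Type) (r : seq I) (P : pred I)
    (f : I -> Q -> K) :
  zariski_open U -> (forall i, P i -> regular_on U (f i)) ->
  regular_on U (fun q => \prod_(i <- r | P i) f i q).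
Proof.
move=> Uo freg; elim: r => [|i r IHr].
  by apply: eq_regular (regular_const 1 Uo) => q _; rewrite big_nil.
have [Pi|nPi] := boolP (P i).
  by apply: eq_regular (regularM (freg i Pi) IHr) => q _; rewrite big_cons Pi.
by apply: eq_regular IHr => q _; rewrite big_cons (negPf nPi).
Qed.

Lemma regularX (U : set Q) (f : Q -> K) n : zariski_open U ->
  regular_on U f -> regular_on U (fun q => f q ^+ n).
Proof.
move=> Uo freg; apply: eq_regular (@regular_prod U _ (index_iota 0 n) predT _ Uo
  (fun _ _ => freg)) => q _.
by rewrite prodr_const_nat subn0.
Qed.

Lemma regular_det (U : set Q) r (A : Q -> 'M[K]_r) :
  zariski_open U -> regular_mx U A -> regular_on U (fun q => \det (A q)).
Proof.
move=> Uo Areg; apply: regular_sum => // s _; apply: regularM.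
  exact: regular_const.
exact: regular_prod.
Qed.

Lemma regular_invmx (U : set Q) r (A : Q -> 'M[K]_r) :
  zariski_open U -> (forall q, U q -> A q \in unitmx) ->
  regular_mx U A -> regular_mx U (fun q => invmx (A q)).
Proof.
move=> Uo Aunit Areg i j.
apply: (@eq_regular _ (fun q => (\det (A q))^-1 * cofactor (A q) j i)).
  by move=> q Uq; rewrite /invmx Aunit // !mxE.
apply: regularM.
  apply: regularV; last exact: regular_det.
  by move=> q /Aunit; rewrite unitmxE unitfE.
apply: regularM; first exact: regular_const.
apply: regular_det => // i' j'.
apply: (@eq_regular _ (fun q => A q (lift j i') (lift i j'))) => // q _.
by rewrite !mxE.
Qed.

End Forms.

(** * Sections of line bundles on the projective line *)

Section ProjectiveLine.

Variable K : closedFieldType.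

Lemma poly_eq_nonzero (p q : {poly K}) :
  (forall t, t != 0 -> p.[t] = q.[t]) -> p = q.
Proof.
move=> pq; apply/eqP; rewrite -subr_eq0; apply/negPn/negP => pq_neq0.
have : 'X * (p - q) != 0 by rewrite mulf_neq0 ?polyX_eq0.
case/closed_nonrootP=> t; rewrite rootM negb_or /root hornerX => /andP[t_neq0].
by rewrite hornerD hornerN pq // subrr eqxx.
Qed.

(** Cancelling a root of the denominator of P / G keeps the identity valid at
   the root too, because a second representation with nonzero denominator there
   agrees with it as a polynomial identity.  So the denominator can be made
   constant. *)
Lemma locally_rational_poly (f : K -> K) :
  (forall t0, exists P G : {poly K},
     G.[t0] != 0 /\ forall t, f t * G.[t] = P.[t]) ->
  exists p : {poly K}, forall t, f t = p.[t].
Proof.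
move=> loc.
suff H n (P G : {poly K}) : (size G <= n)%N -> G != 0 ->
    (forall t, f t * G.[t] = P.[t]) ->
    exists p : {poly K}, forall t, f t = p.[t].
  have [P [G [G0 fG]]] := loc 0; apply: (H _ P G (leqnn _)) => //.
  by apply: contraNneq G0 => ->; rewrite horner0.
elim: n P G => [|n IHn] P G; first by rewrite leqn0 size_poly_eq0 => ->.
move=> sG G_neq0 fG; have [sG1|/closed_rootP[t0 Gt0]] := eqVneq (size G) 1%N.
  have /size_poly1P[c c_neq0 Gc] : size G == 1%N by rewrite sG1.
  exists (c^-1 *: P) => t; rewrite hornerZ -fG Gc hornerC.
  by rewrite mulrCA mulVf ?mulr1.
have Pt0 : root P t0 by rewrite /root -fG (eqP Gt0) mulr0.
have [G' defG] := factor_theorem _ _ Gt0.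
have [P' defP] := factor_theorem _ _ Pt0.
have [P1 [G1 [G1t0 fG1]]] := loc t0.
have X_neq0 : 'X - t0%:P != 0 :> {poly K} by rewrite polyXsubC_eq0.
have G'_neq0 : G' != 0.
  by apply: contraNneq G_neq0 => G'0; rewrite defG G'0 mul0r.
have PG : P' * G1 = P1 * G'.
  apply: (mulIf X_neq0); rewrite mulrAC -defP -[RHS]mulrA -defG.
  apply: poly_eq_nonzero => t _.
  by rewrite !hornerM -fG -fG1; ring.
apply: (IHn P' G') => //.
  by move: sG; rewrite defG size_mul // size_XsubC addn2.
move=> t; have [->|t_neq] := eqVneq t t0.
  apply: (mulIf G1t0); rewrite mulrAC fG1.
  by rewrite -!hornerM PG.
have t_neq0 : t - t0 != 0 by rewrite subr_eq0.
apply: (mulIf t_neq0); have := fG t.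
by rewrite defG defP !hornerM !hornerXsubC mulrA.
Qed.

Definition homog (n : nat) (p : {poly K}) (x : P1 K) : K :=
  \sum_(i < n.+1) p`_i * (hcoord x ord0 ^+ i * hcoord x ord_max ^+ (n - i)).

Lemma hcoord_neq0 (x : P1 K) : exists c, hcoord x c != 0.
Proof.
have [/existsP //|/existsPn x0] := boolP [exists c, hcoord x c != 0].
have : vpick (val x) == 0.
  apply/eqP/rowP => c; rewrite !mxE; apply/eqP; have := x0 c.
  by rewrite negbK /hcoord.
by rewrite vpick0 -dimv_eq0 (eqP (valP x)).
Qed.

Lemma P1_line (x : P1 K) : val x = <[vpick (val x)]>%VS.
Proof.
apply/esym/eqP; rewrite eqEdim -memvE memv_pick (eqP (valP x)) dim_vline.
by rewrite vpick0 -dimv_eq0 (eqP (valP x)).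
Qed.

Lemma eq_P1 (x x' : P1 K) :
  hcoord x ord0 * hcoord x' ord_max = hcoord x ord_max * hcoord x' ord0 ->
  x = x'.
Proof.
move=> xx'; have [c' x'c'] := hcoord_neq0 x'.
have det2 e : hcoord x e * hcoord x' c' = hcoord x c' * hcoord x' e.
  have ordP (f : 'I_2) : f = ord0 \/ f = ord_max.
    by case: f => [[|[|//]] lt_f]; [left|right]; apply: val_inj.
  by have [-> | ->] := ordP e; have [-> | ->] := ordP c'; rewrite // xx'.
have vE : vpick (val x) = (hcoord x c' / hcoord x' c') *: vpick (val x').
  apply/rowP => c; rewrite mxE; apply: (mulIf x'c').
  by rewrite -[LHS]/(hcoord x c * _) det2 mulrAC divfK.
apply: val_inj; apply/eqP; rewrite eqEdim (eqP (valP x)) (eqP (valP x')) leqnn.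
by rewrite andbT (P1_line x) -memvE vE memvZ ?memv_pick.
Qed.

Lemma P1_exists (u v : K) : (u != 0) || (v != 0) ->
  exists x : P1 K, exists2 l, l != 0 &
    hcoord x ord0 = l * u /\ hcoord x ord_max = l * v.
Proof.
move=> uv; pose w : 'rV[K]_2 := \row_c (if c == ord0 then u else v).
have w_neq0 : w != 0.
  apply: contraTneq uv => /rowP w0; have := w0 ord0; have := w0 ord_max.
  by rewrite !mxE /= => -> ->; rewrite eqxx.
have dimw : \dim <[w]>%VS == 1%N by rewrite dim_vline w_neq0.
pose x : P1 K := exist _ <[w]>%VS dimw; exists x.
have /vlineP[l vl] : vpick (val x) \in <[w]>%VS := memv_pick _.
exists l; last by rewrite /hcoord vl !mxE.
apply: contraTneq isT => l0; have [e] := hcoord_neq0 x.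
by rewrite /hcoord vl l0 scale0r mxE eqxx.
Qed.

Lemma homog_eval n (p : {poly K}) (x : P1 K) (l t : K) : (size p <= n.+1)%N ->
  hcoord x ord0 = l * t -> hcoord x ord_max = l -> homog n p x = l ^+ n * p.[t].
Proof.
move=> sp x0 x1; rewrite /homog x0 x1 (horner_coef_wide _ sp) mulr_sumr.
apply: eq_bigr => i _; have le_in : (i <= n)%N by rewrite -ltnS.
have -> : l ^+ n = l ^+ i * l ^+ (n - i) by rewrite -exprD subnKC.
rewrite exprMn.
by move: (l ^+ i) (t ^+ i) (l ^+ (n - i)) => *; ring.
Qed.

Lemma homog_inf n (p : {poly K}) (x : P1 K) : hcoord x ord_max = 0 ->
  homog n p x = hcoord x ord0 ^+ n * p`_n.
Proof.
move=> x1; rewrite /homog big_ord_recr /= subnn expr0 mulr1 x1 big1 ?add0r.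
  by rewrite mulrC.
by move=> i _; rewrite [0 ^+ _]expr0n subn_eq0 leqNgt ltn_ord !mulr0.
Qed.

(** The hypothesis says that g is a section of O(d).  On the affine line it is
   given by a polynomial p, and a representation P / G near infinity with G of
   exact degree m turns regularity there into t ^ (- d) p G = P with P of degree
   at most m, which bounds the degree of p by d. *)
Lemma P1_section (g : P1 K -> K) (d : int) :
  (forall x c, hcoord x c != 0 -> exists m (P G : {poly K}),
     [/\ (size P <= m.+1)%N, (size G <= m.+1)%N, homog m G x != 0 &
         forall x',
           g x' * hcoord x' c ^ (- d) * homog m G x' = homog m P x']) ->
  (forall x, g x = 0) \/
  (exists n : nat, d = n /\ exists2 p : {poly K},
     (size p <= n.+1)%N & forall x, g x = homog n p x).
Proof.
move=> loc.
have [pt ptP] := choice (fun t =>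
  @P1_exists t 1 (introT orP (or_intror (oner_neq0 K)))).
have pt0 t : hcoord (pt t) ord0 = hcoord (pt t) ord_max * t.
  by have [l _ [-> ->]] := ptP t; rewrite mulr1.
have pt1 t : hcoord (pt t) ord_max != 0.
  by have [l l0 [_ ->]] := ptP t; rewrite mulr1.
have ptE x : hcoord x ord_max != 0 -> x = pt (hcoord x ord0 / hcoord x ord_max).
  by move=> x1; apply: eq_P1; rewrite pt0; field.
have [inf [l l0 []]] : exists x : P1 K, exists2 l, l != 0 &
    hcoord x ord0 = l * 1 /\ hcoord x ord_max = l * 0.
  by apply: P1_exists; rewrite oner_neq0.
rewrite mulr1 mulr0 => inf0 inf1.
have infE x : hcoord x ord_max = 0 -> x = inf.
  by move=> x1; apply: eq_P1; rewrite x1 inf1 mulr0 mul0r.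
have [p gp] : exists p : {poly K},
    forall t, g (pt t) * hcoord (pt t) ord_max ^ (- d) = p.[t].
  apply: locally_rational_poly => t0.
  have [m [P [G [sP sG Gt0 fG]]]] := loc (pt t0) ord_max (pt1 t0).
  exists P, G; split.
    apply: contraNneq Gt0 => Gt0.
    by rewrite (homog_eval sG (pt0 _) erefl) Gt0 mulr0.
  move=> t; have := fG (pt t).
  rewrite !(homog_eval _ (pt0 _) erefl) // mulrCA.
  by apply: mulfI; rewrite expf_neq0.
have inf0_neq0 : hcoord inf ord0 != 0 by rewrite inf0.
have [m [P [G [sP sG]]]] := loc inf ord0 inf0_neq0.
rewrite homog_inf // mulf_eq0 negb_or => /andP[_ Gm] fG.
have G_neq0 : G != 0 by apply: contraNneq Gm => ->; rewrite coef0.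
have sGm : size G = m.+1.
  apply/eqP; rewrite eqn_leq sG /= ltnNge.
  by apply: contra Gm => /leq_sizeP ->.
have pG t : t != 0 -> p.[t] * t ^ (- d) * G.[t] = P.[t].
  move=> t0; apply: (mulfI (expf_neq0 m (pt1 t))); have := fG (pt t).
  rewrite !(homog_eval _ (pt0 _) erefl) // => <-; rewrite mulrCA.
  by rewrite pt0 expfzMl -gp !mulrA.
have gE x : hcoord x ord_max != 0 ->
    g x = hcoord x ord_max ^ d * p.[hcoord x ord0 / hcoord x ord_max].
  move=> x1; rewrite -gp -ptE // mulrC -mulrA -expfzDr // addNr expr0z mulr1 //.
have [p0|p_neq0] := eqVneq p 0.
  left=> x; have [x1|x1] := eqVneq (hcoord x ord_max) 0; last first.
    by rewrite gE // p0 horner0 mulr0.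
  have P0 : P = 0.
    by apply: poly_eq_nonzero => t t0; rewrite -pG // p0 horner0 !mul0r.
  have := fG inf; rewrite !homog_inf // P0 coef0 mulr0 => /eqP.
  rewrite !mulf_eq0 (negPf Gm) expf_eq0 (negPf inf0_neq0) andbF /= !orbF.
  by rewrite (infE _ x1) expfz_eq0 (negPf inf0_neq0) andbF orbF => /eqP.
case: d fG pG gp gE {loc} => n fG pG gp gE; last first.
  have defP : p * 'X^(n.+1) * G = P.
    apply: poly_eq_nonzero => t t0; rewrite -pG // !hornerM hornerXn.
    by rewrite NegzE opprK.
  have := sP; rewrite -defP size_mul ?mulf_neq0 ?expf_neq0 ?polyX_eq0 //.
  rewrite size_mulXn // sGm addnS /=.
  have : (0 < size p)%N by rewrite size_poly_gt0.
  move: (size p) => s s_gt0 s_le; exfalso; lia.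
have defP : p * G = 'X^n * P.
  apply: poly_eq_nonzero => t t0; rewrite !hornerM hornerXn -pG //.
  rewrite -[t ^ _]/(t ^ (- n%:Z)) -exprnN.
  move: (t ^+ n) (expf_neq0 n t0) => u u0.
  by field.
have sp : (size p <= n.+1)%N.
  have : (size (p * G)%R <= n + m.+1)%N.
    rewrite defP (leq_trans (size_polyMleq _ _)) // size_polyXn addSn /=.
    by rewrite leq_add2l.
  by rewrite size_mul // sGm addnS /= -addSnnS leq_add2r.
right; exists n; split=> //; exists p => // x.
have [x1|x1] := eqVneq (hcoord x ord_max) 0; last first.
  rewrite gE // (@homog_eval _ _ _ (hcoord x ord_max)
                   (hcoord x ord0 / hcoord x ord_max)) //.
  by rewrite mulrCA mulfV ?mulr1.
rewrite (infE _ x1) homog_inf //.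
have PmE : P`_m = p`_n * G`_m.
  have := congr1 (fun u : {poly K} => u`_(n + m)) defP.
  rewrite coefXnM ltnNge leq_addr /= addKn => <-.
  rewrite coefM (bigD1 (inord n)) //= inordK ?ltnS ?leq_addr // addKn.
  rewrite big1 ?addr0 // => i ne_in.
  have [lt_in|] := ltnP i n.
    rewrite [G`__]nth_default ?mulr0 // sGm; lia.
  rewrite leq_eqVlt => /orP[/eqP ni|lt_ni]; last first.
    by rewrite nth_default ?mul0r // (leq_trans sp).
  by case/eqP: ne_in; apply: val_inj; rewrite /= inordK // ni ltnS; lia.
have := fG inf; rewrite !homog_inf // PmE mulrCA.
move=> /(mulfI (expf_neq0 m inf0_neq0)) /(mulIf Gm) <-.
by rewrite -exprnN mulrCA mulfV ?mulr1 // expf_neq0.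
Qed.

End ProjectiveLine.

(** * Forms in the first variable *)

Section FirstVariable.

Variable K : closedFieldType.
Local Notation Q := (quadric K).

Lemma bihom_restrict_x m n (g : Q -> K) (y : P1 K) : bihom m n g ->
  exists2 p : {poly K}, (size p <= m.+1)%N & forall x, g (x, y) = homog m p x.
Proof.
move=> [F Fg]; exists (\poly_(i < m.+1) \sum_(j < n.+1) F (inord i) j
   * (hcoord y ord0 ^+ j * hcoord y ord_max ^+ (n - j))).
  exact: size_poly.
move=> x; rewrite Fg /bieval /homog; apply: eq_bigr => i _.
rewrite coef_poly ltn_ord inord_val mulr_suml; apply: eq_bigr => j _ /=.
by rewrite -!mulrA; congr (_ * _); rewrite !mulrA; ring.
Qed.

Lemma bihom_restrict_y m n (g : Q -> K) (x : P1 K) : bihom m n g ->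
  exists2 p : {poly K}, (size p <= n.+1)%N & forall y, g (x, y) = homog n p y.
Proof.
move=> [F Fg]; exists (\poly_(j < n.+1) \sum_(i < m.+1) F i (inord j)
   * (hcoord x ord0 ^+ i * hcoord x ord_max ^+ (m - i))).
  exact: size_poly.
move=> y; rewrite Fg /bieval /homog exchange_big; apply: eq_bigr => j _ /=.
by rewrite coef_poly ltn_ord inord_val mulr_suml; apply: eq_bigr => i _ /=.
Qed.

Definition xform (n : nat) (g : Q -> K) : Prop :=
  exists2 p : {poly K}, (size p <= n.+1)%N & forall q, g q = homog n p q.1.

Lemma bihom_xform n (g : Q -> K) : xform n g -> bihom n 0 g.
Proof.
case=> p sp gp; apply: (@eq_bihom _ _ _ (fun q => \sum_(i < n.+1)
    p`_i * monomial i (n - i) 0 0 q)).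
  move=> q; rewrite gp; apply: eq_bigr => i _.
  by rewrite /monomial !expr0 !mulr1.
apply: bihom_sum => i _; apply: bihomZ; have := @bihom_monomial K i (n - i) 0 0.
by rewrite subnKC // -ltnS.
Qed.

(** A section of O(d, 0) on the surface: each ruling in the second direction is
   a projective line, on which it restricts to a constant, so it is a form in
   the first variable. *)
Lemma section_xform (g : Q -> K) (d : int) :
  (forall c, regular_on [set q | hcoord q.1 c != 0]
     (fun q => g q * hcoord q.1 c ^ (- d))) ->
  (forall q, g q = 0) \/ exists2 n : nat, d = n & xform n g.
Proof.
move=> greg; have g_const x y y' : g (x, y) = g (x, y').
  have [c xc] := hcoord_neq0 x; have xd : hcoord x c ^ (- d) != 0.
    by rewrite expfz_neq0.
  apply: (mulIf xd).
  have [||[n [n0 [p _ gp]]]] :=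
    @P1_section K (fun y => g (x, y) * hcoord x c ^ (- d)) 0.
  - move=> z e _; have /regular_onP/(_ (x, z) xc) := greg c.
    case=> m [n [P [G [PP GP Gz _ fG]]]].
    have [P' sP' PE] := bihom_restrict_y x PP.
    have [G' sG' GE] := bihom_restrict_y x GP.
    exists n, P', G'; split=> //; first by rewrite -GE.
    by move=> z'; rewrite oppr0 expr0z mulr1 -GE -PE; apply: fG.
  - by move=> g0; rewrite !g0.
  case: n0 gp => <- gp; rewrite !gp /homog !big_ord_recl !big_ord0.
  by rewrite !expr0.
have [y0] : exists y : P1 K, True.
  by have [|y] := @P1_exists K 1 0; [rewrite oner_eq0 | exists y].
move=> _; have gE q : g q = g (q.1, y0) by case: q => x y /=; apply: g_const.
have [||[n [dn [p sp gp]]]] := @P1_section K (fun x => g (x, y0)) d.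
- move=> x c xc; have /regular_onP/(_ (x, y0) xc) := greg c.
  case=> m [n [P [G [PP GP Gx _ fG]]]].
  have [P' sP' PE] := bihom_restrict_x y0 PP.
  have [G' sG' GE] := bihom_restrict_x y0 GP.
  exists m, P', G'; split=> //; first by rewrite -GE.
  by move=> x'; rewrite -GE -PE; apply: fG.
- by move=> g0; left=> q; rewrite gE.
by right; exists n => //; exists p => // q; rewrite gE.
Qed.

Lemma homog_mulX n (p : {poly K}) x :
  homog n.+1 (p * 'X) x = hcoord x ord0 * homog n p x.
Proof.
rewrite /homog big_ord_recl coefMX /= mul0r add0r mulr_sumr.
apply: eq_bigr => i _; rewrite /bump /= coefMX /= add1n subSS exprS.
by rewrite -!mulrA mulrCA.
Qed.

Lemma homog_raise n (p : {poly K}) x : (size p <= n.+1)%N ->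
  homog n.+1 p x = hcoord x ord_max * homog n p x.
Proof.
move=> sp; rewrite /homog big_ord_recr /= nth_default // mul0r addr0 mulr_sumr.
apply: eq_bigr => i _; rewrite subSn -1?ltnS // exprS.
by move: (_ ^+ i) (_ ^+ (n - i)) => *; ring.
Qed.

Lemma homogBZ n (p q : {poly K}) c x :
  homog n (p - c *: q) x = homog n p x - c * homog n q x.
Proof.
rewrite /homog mulr_sumr -sumrB; apply: eq_bigr => i _.
by rewrite coefB coefZ mulrBl mulrA.
Qed.

Definition line_form (x0 : P1 K) (q : Q) : K :=
  hcoord q.1 ord0 * hcoord x0 ord_max - hcoord q.1 ord_max * hcoord x0 ord0.

Lemma bihom_line x0 : bihom 1 0 (line_form x0).
Proof.
apply: eq_bihom (bihomD (bihomZ (hcoord x0 ord_max) (bihom_x K ord0))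
                      (bihomZ (- hcoord x0 ord0) (bihom_x K ord_max))) => q.
by rewrite /line_form; ring.
Qed.

Lemma line_form_eq0 x0 q : line_form x0 q = 0 -> q.1 = x0.
Proof. by move=> /eqP; rewrite subr_eq0 => /eqP /eq_P1. Qed.

Lemma xform_root n (g : Q -> K) : xform n.+1 g ->
  exists x0, forall y, g (x0, y) = 0.
Proof.
case=> p sp gp; have [pn|pn] := eqVneq p`_n.+1 0.
  have [|x [l l0 [x0 x1]]] := @P1_exists K 1 0; first by rewrite oner_eq0.
  by exists x => y; rewrite gp homog_inf ?pn ?mulr0 //= x1 mulr0.
have /closed_rootP[t /eqP pt] : size p != 1%N.
  by apply: contraNneq pn => sp1; rewrite nth_default // sp1.
have [|x [l l0 [x0 x1]]] := @P1_exists K t 1; first by rewrite oner_eq0 orbT.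
exists x => y; rewrite gp (homog_eval sp x0) ?pt ?mulr0 //=.
by rewrite x1 mulr1.
Qed.

Lemma xform_factor n (g : Q -> K) x0 y0 : xform n.+1 g -> g (x0, y0) = 0 ->
  exists2 g', xform n g' & forall q, g q = line_form x0 q * g' q.
Proof.
(* At infinity, where x_1 = 0, vanishing means that the leading coefficient of
   degree n.+1 is zero, so that x_1 divides the form. *)
case=> p sp gp; rewrite gp /=; have [x1|x1] := eqVneq (hcoord x0 ord_max) 0.
  have x00 : hcoord x0 ord0 != 0.
    have [c] := hcoord_neq0 x0; case: c => [[|[|//]] lt_c].
      by congr (hcoord _ _ != _); apply: val_inj.
    rewrite [X in hcoord _ X](_ : _ = ord_max) ?x1 ?eqxx //; exact: val_inj.
  rewrite homog_inf // => /eqP; rewrite mulf_eq0 expf_eq0 (negPf x00) andbF /=.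
  move=> /eqP pn; have {}sp : (size p <= n.+1)%N.
    rewrite -ltnS ltn_neqAle sp andbT; apply: contra_eqN pn => /eqP spn.
    have := lead_coef_eq0 p; rewrite lead_coefE spn /= => ->.
    by rewrite -size_poly_eq0 spn.
  exists (fun q => - (hcoord x0 ord0)^-1 * homog n p q.1).
    exists (- (hcoord x0 ord0)^-1 *: p).
      exact: leq_trans (size_scale_leq _ _) sp.
    move=> q; rewrite /homog mulr_sumr; apply: eq_bigr => i _.
    by rewrite coefZ mulrA.
  by move=> q; rewrite gp homog_raise // /line_form x1; field.
rewrite (@homog_eval _ _ _ _ _ (hcoord x0 ord0 / hcoord x0 ord_max) sp _ erefl);
  last first.
  by rewrite mulrCA mulfV ?mulr1.
move=> /eqP; rewrite mulf_eq0 expf_eq0 (negPf x1) andbF /= => pt.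
have [p' defp] := factor_theorem _ _ pt.
have [p0|p'0] := eqVneq p' 0.
  exists (fun=> 0) => [|q]; last first.
    rewrite gp defp p0 mul0r /homog mulr0 big1 // => i _.
    by rewrite coef0 mul0r.
  exists 0; rewrite ?size_poly0 // => q.
  by rewrite /homog big1 // => i _; rewrite coef0 mul0r.
have sp' : (size p' <= n.+1)%N.
  by move: sp; rewrite defp size_mul ?polyXsubC_eq0 // size_XsubC addn2.
exists (fun q => (hcoord x0 ord_max)^-1 * homog n p' q.1).
  exists ((hcoord x0 ord_max)^-1 *: p').
    exact: leq_trans (size_scale_leq _ _) sp'.
  move=> q; rewrite /homog mulr_sumr; apply: eq_bigr => i _.
  by rewrite coefZ mulrA.
move=> q; rewrite gp defp mulrBr -[p' * _%:P]mulrC mul_polyC homogBZ homog_mulX.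
by rewrite homog_raise // /line_form; field.
Qed.

End FirstVariable.

(** * Twisted frames of a bundle whose determinant is O(a, 0) *)

Definition chart (K : fieldType) (c : 'I_2) : set (quadric K) :=
  [set q | hcoord q.1 c != 0].

(** The k-th column of Phi is a section of E(- a_ k, 0), written as a function
   of the homogeneous coordinates of the first variable: rescaling these by l
   multiplies it by l ^ (- a_ k), and the product with x_c ^ a_ k is a
   well-defined function.  This avoids a choice of chart for the line bundle. *)
Definition twisted (K : fieldType) (r s : nat) (E : cocycle K (quadric K) r)
    (a_ : 'I_s -> nat) (Phi : idx E -> quadric K -> 'M[K]_(r, s)) : Prop :=
  (forall i j p, dom i p -> dom j p -> Phi i p = trans i j p *m Phi j p) /\
  (forall i c k l, regular_on (dom i `&` chart c)
     (fun p => Phi i p k l * hcoord p.1 c ^+ a_ l)).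

(** An isomorphism from det E to O(a, 0), in the same convention: a section
   of det E, multiplied by delta, is homogeneous of degree a in the first
   variable and the same in all trivializations of E. *)
Definition volume_form (K : fieldType) (r : nat) (E : cocycle K (quadric K) r)
    (a : int) (delta : idx E -> quadric K -> K) : Prop :=
  [/\ forall i p, dom i p -> delta i p != 0,
      forall i j p, dom i p -> dom j p ->
        delta j p = delta i p * \det (trans i j p) &
      forall i c, regular_on (dom i `&` chart c)
        (fun p => delta i p * hcoord p.1 c ^ (- a))].

Definition set_col (K : fieldType) (r s : nat) (k : 'I_s) (A : 'M[K]_(r, s))
    (v : 'cV[K]_r) : 'M[K]_(r, s) :=
  \matrix_(i, j) if j == k then v i 0 else A i j.

Section SetCol.

Variables (K : fieldType).

Lemma mulmx_set_col m r s (k : 'I_s) (T : 'M[K]_(m, r)) A v :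
  T *m set_col k A v = set_col k (T *m A) (T *m v).
Proof.
apply/matrixP => i j; rewrite !mxE; case: ifP => jk; apply: eq_bigr => l _.
  by rewrite mxE jk.
by rewrite mxE jk.
Qed.

Lemma det_set_col r (k : 'I_r) (A : 'M[K]_r) v :
  \det (set_col k A v) = (\adj A *m v) k 0.
Proof.
rewrite (expand_det_col _ k) mxE; apply: eq_bigr => i _.
rewrite !mxE eqxx mulrC; congr (_ * _ * _); congr (\det _).
by apply/matrixP => i' j'; rewrite !mxE eq_sym (negPf (neq_lift _ _)).
Qed.

Lemma det_set_col_mulmx r (k : 'I_r) (A : 'M[K]_r) (u : 'cV_r) :
  \det (set_col k A (A *m u)) = \det A * u k 0.
Proof. by rewrite det_set_col mulmxA mul_adj_mx mul_scalar_mx mxE. Qed.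

End SetCol.

Section Modification.

Variables (K : closedFieldType) (r : nat).
Local Notation Q := (quadric K).
Variables (E : cocycle K Q r) (a : int) (delta : idx E -> Q -> K).
Hypotheses (E_bundle : vector_bundle E) (E_gg : globally_generated E).
Hypothesis delta_vol : volume_form a delta.

Lemma open_chart c : zariski_open (@chart K c).
Proof. exact: zariski_open_bihom (bihom_x _ c). Qed.

Lemma open_dom (i : idx E) : zariski_open (dom i).
Proof. by case: E_bundle. Qed.

Lemma open_dom_chart (i : idx E) c : zariski_open (dom i `&` chart c).
Proof. by apply: zariski_openI; [apply: open_dom | apply: open_chart]. Qed.

(** The determinant has degree - sum a_k and delta has degree a, so their
   product is a section of O(a - sum a_k, 0). *)
Lemma twisted_det (a_ : 'I_r -> nat) (Phi : idx E -> Q -> 'M[K]_r) :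
  twisted a_ Phi ->
  exists D : Q -> K,
    (forall i p, dom i p -> D p = delta i p * \det (Phi i p)) /\
    ((forall q, D q = 0) \/
     exists2 n : nat, a = (n + \sum_k a_ k)%N & xform n D).
Proof.
move=> [Phi_trans Phi_reg]; have [cover _ _ _ _] := E_bundle.
have [_ d_trans d_reg] := delta_vol.
have [ind indP] := choice cover.
pose D q := delta (ind q) q * \det (Phi (ind q) q).
have DE i p : dom i p -> D p = delta i p * \det (Phi i p).
  move=> ip; have jp := indP p.
  by rewrite /D (d_trans i) // (Phi_trans i (ind p)) // det_mulmx mulrA.
exists D; split=> //.
pose A := (\sum_k a_ k)%N.
have [||[n aA Dn]] := @section_xform K D (a - A%:Z).
- move=> c; apply: regular_local => p cp; have ip := indP p.
  exists (dom (ind p) `&` chart c).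
  exists (fun q => (delta (ind p) q * hcoord q.1 c ^ (- a))
     * \det (Phi (ind p) q *m diag_mx (\row_k hcoord q.1 c ^+ a_ k))).
  split; [by split | by move=> q [] | |].
    apply: regularM; first exact: d_reg.
    apply: regular_det; first exact: open_dom_chart.
    move=> k l; apply: eq_regular (Phi_reg (ind p) c k l) => q _.
    by rewrite mul_mx_diag !mxE.
  move=> q [iq cq]; rewrite (DE _ _ iq) det_mulmx det_diag.
  rewrite (eq_bigr (fun k => hcoord q.1 c ^+ a_ k)); last first.
    by move=> k _; rewrite mxE.
  rewrite -expr_sum -/A opprB addrC expfzDr //.
  rewrite -[hcoord q.1 c ^ A%:Z]/(hcoord q.1 c ^+ A).
  by move: (_ ^ (- a)) (_ ^+ A) => *; ring.
- by left.
right; exists n => //; move/eqP: aA; rewrite subr_eq => /eqP ->.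
by rewrite PoszD.
Qed.

Lemma gg_frame i p : dom i p -> exists2 S : idx E -> Q -> 'M[K]_r,
  twisted (fun=> 0%N) S & S i p = 1%:M.
Proof.
move=> ip.
have [s sP] := choice (fun k : 'I_r => E_gg ip (delta_mx k 0)).
exists (fun j q => \matrix_(l, k) s k j q l 0).
  split=> [j j' q jq j'q|j c k l].
    apply/matrixP => l k; rewrite !mxE; have [[_ strans] _] := sP k.
    by rewrite (strans j j') // mxE; apply: eq_bigr => m _; rewrite mxE.
  have [[sreg _] _] := sP l.
  apply: (@eq_regular _ _ (fun q => s l j q k 0)) => [q _|].
    by rewrite mxE expr0 mulr1.
  by apply: regular_sub (sreg j k 0) => [|q []//]; apply: open_dom_chart.
apply/matrixP => l k; rewrite !mxE; have [_ ->] := sP k.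
by rewrite mxE andbT.
Qed.

Lemma regular_x_ratio (U : set Q) c (x0 : P1 K) : zariski_open U ->
  (forall q, U q -> line_form x0 q != 0) ->
  regular_on U (fun q => hcoord q.1 c / line_form x0 q).
Proof.
move=> Uo Ul; apply: (@regular_ratio _ _ 1 0) => //; first exact: bihom_x.
exact: bihom_line.
Qed.

(** A zero x0 of the determinant gives a combination psi of the columns that
   vanishes at a point (x0, y0).  Cramer's rule in a frame S of global sections
   that is invertible at (x0, y0), hence along the ruling over x0, expresses psi
   by forms in x alone.  These vanish at x0, so psi can be divided by the
   equation of x0. *)
Lemma elementary_modification (a_ : 'I_r -> nat)
    (Phi : idx E -> Q -> 'M[K]_r) n :
  twisted a_ Phi -> a = (n.+1 + \sum_k a_ k)%N ->
  (exists i p, dom i p /\ \det (Phi i p) != 0) ->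
  exists (b_ : 'I_r -> nat) (Psi : idx E -> Q -> 'M[K]_r),
    [/\ twisted b_ Psi, a = (n + \sum_k b_ k)%N &
        exists i p, dom i p /\ \det (Psi i p) != 0].
Proof.
move=> Phi_tw aE [i1 [p1 [ip1 Phi1]]].
have [cover _ trans_reg _ _] := E_bundle.
have [d_neq0 d_trans d_reg] := delta_vol.
have [D [DE Dx]] := twisted_det Phi_tw.
have {Dx}[x0 Dx0] : exists x0, forall y, D (x0, y) = 0.
  case: Dx => [D0|[m]]; first by exists p1.1.
  rewrite aE => -[/addIn <-]; exact: xform_root.
pose y0 := p1.2; pose p0 : Q := (x0, y0).
have [i0 ip0] := cover p0.
have [v v_neq0 Phi_v] : exists2 v : 'cV[K]_r, v != 0 & Phi i0 p0 *m v = 0.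
  have : \det (Phi i0 p0)^T == 0.
    have /eqP := Dx0 y0; rewrite (DE i0) // mulf_eq0 (negPf (d_neq0 _ _ ip0)).
    by rewrite det_tr.
  case/det0P=> u u0 uPhi; exists u^T.
    by apply: contraNneq u0 => uT; rewrite -[u]trmxK uT trmx0.
  by apply: trmx_inj; rewrite trmx_mul trmxK uPhi trmx0.
have [k0 vk0] : exists k, v k 0 != 0.
  by have /cV0Pn[k] := v_neq0; exists k.
(* The degrees a_ j - a_ k must be nonnegative wherever v j <> 0. *)
case: (@arg_minnP _ k0 (fun k => v k 0 != 0) a_ vk0) => k vk k_min.
have [e xe] := hcoord_neq0 x0.
(* The ratio x_e / x_e(x0) is a linear form with value 1 at x0, so u p0 = v. *)
pose u (q : Q) : 'cV[K]_r :=
  \col_j (v j 0 * (hcoord q.1 e / hcoord x0 e) ^+ (a_ j - a_ k)).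
pose psi i q := Phi i q *m u q.
have [Phi_trans Phi_reg] := Phi_tw.
have psi_trans i j p : dom i p -> dom j p -> psi i p = trans i j p *m psi j p.
  by move=> ip jp; rewrite /psi (Phi_trans i j) // mulmxA.
have psi_reg i c l : regular_on (dom i `&` chart c)
    (fun q => psi i q l 0 * hcoord q.1 c ^+ a_ k).
  apply: (@eq_regular _ _ (fun q => \sum_j (Phi i q l j * hcoord q.1 c ^+ a_ j)
     * (v j 0 * (hcoord q.1 e / hcoord x0 e / hcoord q.1 c) ^+ (a_ j - a_ k)))).
    move=> q [_ cq]; rewrite /psi mxE mulr_suml; apply: eq_bigr => j _.
    rewrite mxE; have [->|vj] := eqVneq (v j 0) 0.
      by rewrite !mul0r !mulr0 mul0r.
    have -> : hcoord q.1 c ^+ a_ j =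
        hcoord q.1 c ^+ (a_ j - a_ k) * hcoord q.1 c ^+ a_ k.
      by rewrite -exprD subnK ?k_min.
    rewrite [(_ / hcoord q.1 c) ^+ _]expr_div_n.
    move: (_ ^+ (a_ j - a_ k)) (expf_neq0 (a_ j - a_ k) cq) => z z_neq0.
    by move: ((_ / _) ^+ (a_ j - a_ k)) (_ ^+ a_ k) => z' w; field.
  apply: regular_sum => [|j _]; first exact: open_dom_chart.
  apply: regularM; first exact: Phi_reg.
  apply: regularM; first by apply: regular_const; apply: open_dom_chart.
  apply: regularX; first exact: open_dom_chart.
  apply: (@eq_regular _ _
    (fun q => (hcoord x0 e)^-1 * (hcoord q.1 e / hcoord q.1 c))).
    by move=> q [_ cq]; ring.
  apply: regularM; first by apply: regular_const; apply: open_dom_chart.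
  apply: (@regular_ratio _ _ 1 0); [exact: open_dom_chart | by move=> q []| |];
    exact: bihom_x.
have psi0 : psi i0 p0 = 0.
  rewrite /psi -[RHS]Phi_v; congr (_ *m _); apply/colP => j.
  by rewrite mxE /p0 /= divff // expr1n mulr1.
have [S S_tw S1] := gg_frame ip0.
have [DS [DSE DSx]] := twisted_det S_tw.
have DSp0 : DS p0 != 0 by rewrite (DSE i0) // S1 det1 mulr1 d_neq0.
have [m am DSm] : exists2 m : nat, a = m & xform m DS.
  case: DSx => [DS0|[m am DSm]]; first by rewrite DS0 eqxx in DSp0.
  by exists m => //; rewrite am big1_eq addn0.
have [S_trans S_reg] := S_tw.
have le_ak : (a_ k <= \sum_j a_ j)%N by rewrite (bigD1 k) //= leq_addr.
have [A AE] : exists A, A = (\sum_j a_ j)%N by eexists.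
rewrite -AE in aE le_ak.
pose N := (n + A - a_ k)%N.
(* Cramer's rule: the coordinates of psi in the frame S are quotients by DS of
   the determinants of S with one column replaced by psi. *)
have w_ex l : exists w : Q -> K, xform N w /\ forall i q, dom i q ->
    delta i q * (\adj (S i q) *m psi i q) l 0 = line_form x0 q * w q.
  pose c_ (j : 'I_r) := if j == l then a_ k else 0%N.
  have T_tw : twisted c_ (fun i q => set_col l (S i q) (psi i q)).
    split=> [i j q iq jq|i c j j'].
      by rewrite mulmx_set_col -S_trans // -psi_trans.
    apply: (@eq_regular _ _ (fun q =>
      (if j' == l then psi i q j 0 else S i q j j') * hcoord q.1 c ^+ c_ j')).
      by move=> q _; rewrite [set_col _ _ _ _ _]mxE.
    by rewrite /c_; case: (j' == l); [apply: psi_reg | apply: S_reg].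
  have [W [WE Wx]] := twisted_det T_tw.
  have Wp0 : W (x0, y0) = 0.
    by rewrite (WE i0) // psi0 det_set_col mulmx0 mxE mulr0.
  have {}Wx : xform N.+1 W.
    case: Wx => [W0|[N' aN' WN']].
      exists 0; rewrite ?size_poly0 // => q.
      by rewrite W0 /homog big1 // => i _; rewrite coef0 mul0r.
    rewrite -(_ : N' = N.+1) //; move: aN'.
    rewrite aE /c_ -big_mkcond big_pred1_eq.
    by case; rewrite /N; lia.
  have [w wN Ww] := xform_factor Wx Wp0.
  by exists w; split=> // i q iq; rewrite -Ww (WE i) // det_set_col.
have [w wP] := choice w_ex.
have psiE i q : dom i q ->
    DS q *: psi i q = line_form x0 q *: (S i q *m \col_l w l q).
  move=> iq; rewrite (DSE i) // [RHS]scalemxAr.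
  have -> : line_form x0 q *: \col_l w l q =
      delta i q *: (\adj (S i q) *m psi i q).
    by apply/colP => l; rewrite !mxE -(proj2 (wP l) i q iq) !mxE.
  by rewrite -scalemxAr mulmxA mul_mx_adj mul_scalar_mx scalerA.
(* The branches are given by the same formula off the zeros of DS, and DS has no
   zero on the ruling over x0; so the second one extends psi / line_form x0. *)
pose phi i q := if line_form x0 q != 0 then (line_form x0 q)^-1 *: psi i q
  else (DS q)^-1 *: (S i q *m \col_l w l q).
have phiE i q : dom i q -> DS q != 0 ->
    phi i q = (DS q)^-1 *: (S i q *m \col_l w l q).
  move=> iq DSq; rewrite /phi; case: ifP => // lq.
  apply: (scalerI DSq); rewrite scalerA mulrC -scalerA psiE // !scalerA.
  by rewrite mulVf // mulfV.
have phi_trans i j q : dom i q -> dom j q -> phi i q = trans i j q *m phi j q.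
  move=> iq jq; rewrite /phi; case: ifP => _; rewrite -scalemxAr.
    by rewrite -psi_trans.
  by rewrite mulmxA -S_trans.
have phi_reg i c l : regular_on (dom i `&` chart c)
    (fun q => phi i q l 0 * hcoord q.1 c ^+ (a_ k).+1).
  have Uo : zariski_open (dom i `&` chart c) by apply: open_dom_chart.
  apply: regular_local => q iq; have [lq|lq] := eqVneq (line_form x0 q) 0.
    have DSq : DS q != 0.
      by case: DSm DSp0 => P _ DSP; rewrite !DSP (line_form_eq0 lq).
    have Vo : zariski_open ((dom i `&` chart c) `&` [set q | DS q != 0]).
      apply: zariski_openI => //.
      exact: zariski_open_bihom (bihom_xform DSm).
    exists ((dom i `&` chart c) `&` [set q | DS q != 0]).
    exists (fun q => \sum_l' (S i q l l' * hcoord q.1 c ^+ 0)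
       * (w l' q * hcoord q.1 c ^+ (a_ k).+1 / DS q)).
    split; [by split | by move=> q' [] | |].
      apply: regular_sum => // l' _; apply: regularM.
        by apply: regular_sub (S_reg i c l l') => // q' [].
      apply: (@regular_ratio _ _ m 0) => //;
        [by move=> q' [] | | exact: bihom_xform].
      have [wN _] := wP l'.
      have := bihomM (bihom_xform wN) (bihomX (a_ k).+1 (bihom_x _ c)).
      rewrite muln1 muln0 addn0 (_ : (N + (a_ k).+1)%N = m) //.
      by move: am; rewrite aE => -[<-]; rewrite /N; lia.
    move=> q' [[iq' _] DSq']; rewrite phiE // !mxE mulr_sumr mulr_suml.
    by apply: eq_bigr => l' _; rewrite mxE expr0 mulr1; ring.
  have Vo : zariski_open
      ((dom i `&` chart c) `&` [set q | line_form x0 q != 0]).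
    by apply: zariski_openI => //; apply: zariski_open_bihom (bihom_line x0).
  exists ((dom i `&` chart c) `&` [set q | line_form x0 q != 0]).
  exists (fun q => (psi i q l 0 * hcoord q.1 c ^+ a_ k)
    * (hcoord q.1 c / line_form x0 q)).
  split; [by split | by move=> q' [] | |].
    apply: regularM; first by apply: regular_sub (psi_reg i c l) => // q' [].
    by apply: regular_x_ratio => // q' [].
  by move=> q' [_ lq']; rewrite /phi lq' mxE exprS; ring.
exists (fun j => a_ j + (j == k))%N, (fun i q => set_col k (Phi i q) (phi i q)).
split.
- split=> [i j q iq jq|i c l j].
    by rewrite mulmx_set_col -Phi_trans // -phi_trans.
  apply: (@eq_regular _ _ (fun q =>
    (if j == k then phi i q l 0 else Phi i q l j)
      * hcoord q.1 c ^+ (a_ j + (j == k)))).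
    by move=> q _; rewrite [set_col _ _ _ _ _]mxE.
  case: eqP => [->|_]; first by rewrite addn1; apply: phi_reg.
  by rewrite addn0; apply: Phi_reg.
- rewrite aE big_split /= -AE -[X in (_ + (_ + X))%N]big_mkcond /= big_pred1_eq.
  by rewrite addSnnS addn1.
(* p1 is off the ruling over x0, so there Psi is Phi up to an invertible column
   operation. *)
exists i1, p1; split=> //.
have l1 : line_form x0 p1 != 0.
  apply: contraNneq Phi1 => /line_form_eq0 p1x0; have := Dx0 p1.2.
  rewrite -p1x0 -surjective_pairing (DE i1) // => /eqP.
  by rewrite mulf_eq0 (negPf (d_neq0 _ _ ip1)).
rewrite /phi l1 scalemxAr det_set_col_mulmx !mxE subnn expr0 mulr1.
by rewrite !mulf_neq0 ?invr_eq0.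
Qed.

(** The excess a - sum a_k drops at each modification; when it reaches 0 the
   determinant is a form of degree 0, that is, a nonzero constant. *)
Lemma everywhere_frame :
  exists (a_ : 'I_r -> nat) (Phi : idx E -> Q -> 'M[K]_r),
  [/\ twisted a_ Phi, a = (\sum_k a_ k)%N &
      forall i p, dom i p -> \det (Phi i p) != 0].
Proof.
have [cover _ _ _ _] := E_bundle; have [d_neq0 _ _] := delta_vol.
suff H n (a_ : 'I_r -> nat) (Phi : idx E -> Q -> 'M[K]_r) :
    twisted a_ Phi -> a = (n + \sum_k a_ k)%N ->
    (exists i p, dom i p /\ \det (Phi i p) != 0) ->
    exists (a_ : 'I_r -> nat) (Phi : idx E -> Q -> 'M[K]_r),
    [/\ twisted a_ Phi, a = (\sum_k a_ k)%N &
      forall i p, dom i p -> \det (Phi i p) != 0].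
  have [x _] : exists x : P1 K, True.
    by have [|x] := @P1_exists K 1 0; [rewrite oner_eq0 | exists x].
  have [i ip] := cover (x, x).
  have [S S_tw S1] := gg_frame ip.
  have Snz : exists i p, dom i p /\ \det (S i p) != 0.
    by exists i, (x, x); rewrite S1 det1 oner_eq0.
  have [D [DE [D0|[n an _]]]] := twisted_det S_tw; last exact: H S_tw an Snz.
  have /eqP := D0 (x, x).
  by rewrite (DE i) // S1 det1 mulr1 (negPf (d_neq0 _ _ ip)).
elim: n a_ Phi => [|n IHn] a_ Phi Phi_tw aE Phi_nz; last first.
  have [b_ [Psi [Psi_tw bE Psi_nz]]] :=
    elementary_modification Phi_tw aE Phi_nz.
  exact: IHn Psi_tw bE Psi_nz.
exists a_, Phi; split=> // i p ip.
have [i1 [p1 [ip1 Phi1]]] := Phi_nz.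
have [D [DE Dx]] := twisted_det Phi_tw.
have D1 : D p1 != 0 by rewrite (DE i1) // mulf_neq0 ?d_neq0.
have Dp : D p = D p1.
  case: Dx => [D0|[n]]; first by rewrite !D0.
  rewrite aE => -[/addIn <-] [P _ DP].
  by rewrite !DP /homog !big_ord_recl !big_ord0 !expr0.
by apply: contraNneq D1 => Phi0; rewrite -Dp (DE i) // Phi0 mulr0.
Qed.

End Modification.

(** * Trivializations of the determinant and of sums of line bundles *)

Section LineBundles.

Variable K : fieldType.
Local Notation Q := (quadric K).

Definition bichart (J : 'I_2 * 'I_2) : set Q :=
  [set q | hcoord q.1 J.1 != 0] `&` [set q | hcoord q.2 J.2 != 0].

(** The transition functions of O_Q a b are quotients of weights: the section
   given by a form P of bidegree (a, b) is P / weight a b J in the chart J. *)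
Definition weight (a b : int) (J : 'I_2 * 'I_2) (q : Q) : K :=
  hcoord q.1 J.1 ^ a * hcoord q.2 J.2 ^ b.

Lemma weight_neq0 a b J q : bichart J q -> weight a b J q != 0.
Proof. by case=> x0 y0; rewrite mulf_neq0 ?expfz_neq0. Qed.

Lemma weightN a b J q : weight (- a) (- b) J q = (weight a b J q)^-1.
Proof. by rewrite /weight -!invr_expz -invfM. Qed.

Lemma trans_O_Q a b (J J' : 'I_2 * 'I_2) (q : Q) :
  (@trans _ _ _ (O_Q K a b) J J' q : 'M_1) 0 0 =
    weight a b J' q / weight a b J q.
Proof.
have -> : (@trans _ _ _ (O_Q K a b) J J' q : 'M_1) 0 0 =
    (hcoord q.1 J'.1 / hcoord q.1 J.1) ^ a
    * (hcoord q.2 J'.2 / hcoord q.2 J.2) ^ b.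
  rewrite -[RHS]mulr1 /=.
  have := @tensmxE K 1 1 1 1
    ((hcoord q.1 J'.1 / hcoord q.1 J.1) ^ a)%:M
    ((hcoord q.2 J'.2 / hcoord q.2 J.2) ^ b)%:M 0 0 0 0.
  by rewrite !mxE !eqxx !mulr1n mulr1 => <-; congr (_ _ _); apply: val_inj;
     rewrite /= ?ord1.
by rewrite !expfzMl !exprz_inv -!invr_expz /weight invfM; ring.
Qed.

Lemma open_bichart J : zariski_open (bichart J).
Proof.
apply: zariski_openI; first exact: zariski_open_bihom (bihom_x _ _).
exact: zariski_open_bihom (bihom_y _ _).
Qed.

Lemma zariski_open_forall n (U : 'I_n -> set Q) :
  (forall k, zariski_open (U k)) -> zariski_open [set q | forall k, U k q].
Proof.
move=> Uo; suff H (s : seq 'I_n) :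
    zariski_open [set q | forall k, k \in s -> U k q].
  have := H (enum 'I_n); congr (zariski_open _).
  apply/seteqP; split=> q Uq k; first by apply: Uq; rewrite mem_enum.
  by move=> _; apply: Uq.
elim: s => [|k s IHs].
  have := @zariski_open_bihom K 0 0 (fun=> 1) (bihom_const _).
  congr (zariski_open _); apply/seteqP; split=> q //= _.
  by rewrite oner_eq0.
have := zariski_openI (Uo k) IHs; congr (zariski_open _).
apply/seteqP; split=> q /=.
  by case=> Uk Us k'; rewrite inE => /orP[/eqP -> | /Us].
move=> Uks; split=> [|k' k's]; first by apply: Uks; rewrite inE eqxx.
by apply: Uks; rewrite inE k's orbT.
Qed.

End LineBundles.

Section Trivializations.

Variables (K : closedFieldType) (r : nat).
Local Notation Q := (quadric K).
Variable E : cocycle K Q r.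
Hypothesis E_bundle : vector_bundle E.

Lemma bichart_cover (q : Q) : exists J, bichart J q.
Proof.
have [c xc] := hcoord_neq0 q.1; have [e ye] := hcoord_neq0 q.2.
by exists (c, e).
Qed.

(** The isomorphism det E = O(a, b) in the chart J, multiplied by the weight of
   J, does not depend on J. *)
Lemma c1_volume (a b : int) : has_c1 E a b ->
  exists delta : idx E -> Q -> K,
    [/\ forall i p, dom i p -> delta i p != 0,
      forall i j p, dom i p -> dom j p ->
        delta j p = delta i p * \det (trans i j p) &
      forall i J, regular_on (dom i `&` bichart J)
        (fun p => delta i p * weight (- a) (- b) J p)].
Proof.
case=> h [k [[h_reg h_trans] _ hk]].
have [cover dom_open trans_reg trans_id _] := E_bundle.
have [J_ J_P] := choice bichart_cover.
have mul11 (A B : 'M[K]_1) : (A *m B) 0 0 = A 0 0 * B 0 0.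
  by rewrite mxE big_ord1.
have hE (J J' : 'I_2 * 'I_2) (i i' : idx E) p : bichart J p -> bichart J' p ->
    dom i p -> dom i' p -> weight a b J' p * (h J' i' p : 'M_1) 0 0 =
      weight a b J p * (h J i p : 'M_1) 0 0 * \det (trans i i' p).
  move=> Jp J'p ip i'p.
  have -> : (h J' i' p : 'M_1) = (@trans _ _ _ (O_Q K a b) J' J p : 'M_1)
      *m (h J i p : 'M_1) *m (\det (trans i i' p))%:M.
    exact: h_trans.
  rewrite (mul11 _ (\det (trans i i' p))%:M) mul11 trans_O_Q mxE eqxx mulr1n.
  by have := weight_neq0 a b J'p => w'; field.
exists (fun i p => weight a b (J_ p) p * (h (J_ p) i p : 'M_1) 0 0).
split=> [i p ip|i j p ip jp|i J].
- rewrite mulf_neq0 ?weight_neq0 //.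
  have [/matrixP/(_ 0 0) + _] := hk (J_ p) i p (J_P p) ip.
  rewrite (mul11 (h (J_ p) i p) (k i (J_ p) p)) mxE eqxx => hk1.
  by apply: contra_eq_neq hk1 => ->; rewrite mul0r eq_sym oner_eq0.
- exact: hE.
apply: (@eq_regular _ _ (fun p => (h J i p : 'M_1) 0 0)) => [p [ip Jp]|].
  rewrite (hE J (J_ p) i i) // trans_id // det1 mulr1 weightN // mulrAC.
  by rewrite mulfV ?mul1r // weight_neq0.
by rewrite setIC; apply: h_reg.
Qed.

(** The isomorphism from the sum of line bundles to E sends the local generator
   of the l-th summand in the chart J to the l-th column of Phi times the weight
   of J; its inverse is regular because the determinant has no zero. *)
Lemma frame_iso (a_ b_ : 'I_r -> int) (Phi : idx E -> Q -> 'M[K]_r) :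
  (forall i j p, dom i p -> dom j p -> Phi i p = trans i j p *m Phi j p) ->
  (forall i J k l, regular_on (dom i `&` bichart J)
     (fun p => Phi i p k l * weight (a_ l) (b_ l) J p)) ->
  (forall i p, dom i p -> \det (Phi i p) != 0) ->
  bundle_iso E (line_sum (fun l => O_Q K (a_ l) (b_ l))).
Proof.
move=> Phi_trans Phi_reg Phi_det.
have [cover dom_open trans_reg trans_id trans_mul] := E_bundle.
pose L := line_sum (fun l => O_Q K (a_ l) (b_ l)).
pose M (i : idx E) (J : idx L) p : 'M[K]_r :=
  Phi i p *m diag_mx (\row_l weight (a_ l) (b_ l) (J l) p).
have domL (J : idx L) p : dom J p -> forall l, bichart (J l) p by [].
have openL (J : idx L) : zariski_open (dom J).
  by apply: zariski_open_forall => l; apply: open_bichart.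
have open_iL (i : idx E) (J : idx L) : zariski_open (dom i `&` dom J).
  by apply: zariski_openI.
have M_unit i (J : idx L) p : dom i p -> dom J p -> M i J p \in unitmx.
  move=> ip Jp; rewrite unitmx_mul !unitmxE !unitfE Phi_det //= det_diag.
  by apply/prodf_neq0 => l _; rewrite mxE weight_neq0 //; apply: domL.
have M_reg i (J : idx L) : regular_mx (dom i `&` dom J) (M i J).
  move=> k l; apply: (@eq_regular _ _
    (fun p => Phi i p k l * weight (a_ l) (b_ l) (J l) p)) => [p _|].
    by rewrite /M mul_mx_diag !mxE.
  apply: regular_sub (Phi_reg i (J l) k l) => // p [ip Jp].
    by split=> //; apply: domL.
have M_transE i j (J : idx L) p : dom i p -> dom j p ->
    M i J p = trans i j p *m M j J p.
  by move=> ip jp; rewrite /M mulmxA -Phi_trans.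
have M_transL i (J J' : idx L) p : dom J p -> dom J' p ->
    M i J p *m trans J J' p = M i J' p.
  move=> Jp J'p; rewrite /M -mulmxA; congr (_ *m _).
  have -> : trans J J' p = diag_mx (\row_l
      (weight (a_ l) (b_ l) (J' l) p / weight (a_ l) (b_ l) (J l) p)).
    by congr diag_mx; apply/rowP => l; rewrite [LHS]mxE [RHS]mxE trans_O_Q.
  apply/matrixP => k l; rewrite mul_diag_mx !mxE.
  have [->|kl] := eqVneq k l; last by rewrite !mulr0n mulr0.
  rewrite !mulr1n mulrC divfK // weight_neq0 //; exact: domL.
exists (fun J i p => invmx (M i J p)), M; split.
- split=> [J i|J J' i i' p Jp J'p ip i'p].
    rewrite setIC; apply: regular_invmx => // p [ip Jp]; exact: M_unit.
  apply: (can_inj (mulKmx (M_unit i J p ip Jp))).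
  rewrite mulmxV ?M_unit // !mulmxA M_transL // (M_transE i i') //.
  by rewrite mulmxK ?M_unit // trans_mul // trans_id.
- split=> [i J|i i' J J' p ip i'p Jp J'p]; first exact: M_reg.
  by rewrite -mulmxA M_transL // -M_transE.
by move=> J i p Jp ip; rewrite mulVmx ?mulmxV ?M_unit.
Qed.

End Trivializations.

(** * Exchanging the two factors *)

Section Swap.

Variable K : fieldType.
Local Notation Q := (quadric K).

Definition swap (q : Q) : Q := (q.2, q.1).

Lemma swapK : involutive swap. Proof. by case. Qed.

Lemma bihom_swap m n (g : Q -> K) : bihom m n g -> bihom n m (g \o swap).
Proof.
move=> [F Fg]; exists F^T => q; rewrite /= Fg /bieval exchange_big.
apply: eq_bigr => j _; apply: eq_bigr => i _ /=.
by rewrite mxE mulrAC.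
Qed.

Lemma zariski_open_swap (U : set Q) :
  zariski_open U -> zariski_open (swap @^-1` U).
Proof.
move=> /zariski_openP Uo; apply/zariski_openP => p /Uo[m [n [G [GP Gp GU]]]].
exists n, m, (G \o swap); split=> //; first exact: bihom_swap.
by move=> q /GU.
Qed.

Lemma regular_swap (U : set Q) (f : Q -> K) :
  regular_on U f -> regular_on (swap @^-1` U) (f \o swap).
Proof.
move=> /regular_onP freg; apply/regular_onP => p /freg.
case=> m [n [P [G [PP GP Gp GU fG]]]].
exists n, m, (P \o swap), (G \o swap); split=> //; try exact: bihom_swap.
  by move=> q /GU.
by move=> q; apply: fG.
Qed.

Variables (r : nat) (E : cocycle K Q r).

Lemma vector_bundle_swap : vector_bundle E -> vector_bundle (pullback swap E).
Proof.
case=> cover dom_open trans_reg trans_id trans_mul; split.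
- by move=> p; apply: cover.
- by move=> i; apply: zariski_open_swap; apply: dom_open.
- by move=> i j k l; apply: regular_swap (trans_reg i j k l).
- by move=> i p; apply: trans_id.
by move=> i j k p; apply: trans_mul.
Qed.

Lemma globally_generated_swap :
  globally_generated E -> globally_generated (pullback swap E).
Proof.
move=> gg i p ip v; have [s [[s_reg s_trans] sv]] := gg i (swap p) ip v.
exists (fun j q => s j (swap q)); split=> //; split.
  by move=> j k l; apply: regular_swap (s_reg j k l).
by move=> j j' q; apply: s_trans.
Qed.

End Swap.

(** * Splitting *)

Section Splitting.

Variables (K : closedFieldType) (r : nat).
Local Notation Q := (quadric K).
Variable E : cocycle K Q r.
Hypotheses (E_bundle : vector_bundle E) (E_gg : globally_generated E).

Lemma split_first (a : int) : has_c1 E a 0 ->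
  exists a_ : 'I_r -> nat, (\sum_(i < r) a_ i)%N%:Z = a /\
    bundle_iso E (line_sum (fun i => O_Q K (a_ i)%:Z 0)).
Proof.
move=> /(c1_volume E_bundle)[delta [d_neq0 d_trans d_reg]].
have d_vol : volume_form a delta.
  split=> // i c; apply: regular_local => p [ip cp].
  have [e ye] := hcoord_neq0 p.2.
  exists (dom i `&` bichart (c, e)).
  exists (fun p => delta i p * weight (- a) (- 0) (c, e) p).
  split; [by split | by move=> q [iq [cq _]] | exact: d_reg | ].
  by move=> q _; rewrite /weight oppr0 expr0z mulr1.
have [a_ [Phi [[Phi_trans Phi_reg] aE Phi_det]]] :=
  everywhere_frame E_bundle E_gg d_vol.
exists a_; split=> //; apply: (@frame_iso _ _ _ E_bundle _ (fun=> 0) Phi) => //.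
move=> i J k l.
have Uo : zariski_open (dom i `&` bichart J).
  by apply: zariski_openI; [case: E_bundle | exact: open_bichart].
apply: eq_regular (regular_sub Uo _ (Phi_reg i J.1 k l)) =>
  [q _|q [iq [cq _]] //].
by rewrite /weight expr0z mulr1.
Qed.

Lemma split_second (b : int) : has_c1 E 0 b ->
  exists b_ : 'I_r -> nat, (\sum_(i < r) b_ i)%N%:Z = b /\
    bundle_iso E (line_sum (fun i => O_Q K 0 (b_ i)%:Z)).
Proof.
move=> /(c1_volume E_bundle)[delta [d_neq0 d_trans d_reg]].
have d_vol : @volume_form K r (pullback (@swap K) E) b
    (fun i q => delta i (swap q)).
  split=> [i p|i j p|i c]; [exact: d_neq0 | exact: d_trans|].
  apply: regular_local => p [ip cp]; have [e ye] := hcoord_neq0 p.2.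
  exists (@swap K @^-1` (@dom _ _ _ E i `&` bichart (e, c))).
  exists ((fun p => delta i p * weight (- 0) (- b) (e, c) p) \o @swap K).
  split; [by split | by move=> q [iq [_ cq]] |
          exact: regular_swap (d_reg _ _) | ].
  by move=> q _; rewrite /weight /= oppr0 expr0z mul1r.
have [b_ [Phi [[Phi_trans Phi_reg] bE Phi_det]]] :=
  everywhere_frame (vector_bundle_swap E_bundle)
    (globally_generated_swap E_gg) d_vol.
exists b_; split=> //.
apply: (@frame_iso _ _ _ E_bundle (fun=> 0) _ (fun i q => Phi i (swap q))).
- move=> i j p ip jp.
  by rewrite (Phi_trans i j) //= swapK.
- move=> i J k l.
  have Uo : zariski_open (dom i `&` bichart J).
    by apply: zariski_openI; [case: E_bundle | exact: open_bichart].
  have := regular_swap (Phi_reg i J.2 k l) => /(regular_sub Uo) H.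
  apply: eq_regular (H _) => [q _|q [iq [_ cq]]].
    by rewrite /weight /= expr0z mul1r.
  by split=> //; rewrite /= swapK.
by move=> i p ip; apply: Phi_det; rewrite /= swapK.
Qed.

End Splitting.

Theorem lemma3p4 (R : realType) (r : nat) (E : cocycle R[i] (quadric R[i]) r)
    (E_bundle : vector_bundle E) (E_gg : globally_generated E) :
  (forall a : int, has_c1 E a 0 -> ((2 < r)%N -> a <= 2) ->
     exists a_ : 'I_r -> nat,
       (\sum_(i < r) a_ i)%N%:Z = a /\
       bundle_iso E (line_sum (fun i => O_Q R[i] (a_ i)%:Z 0))) /\
  (forall b : int, has_c1 E 0 b -> ((2 < r)%N -> b <= 2) ->
     exists b_ : 'I_r -> nat,
       (\sum_(i < r) b_ i)%N%:Z = b /\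
       bundle_iso E (line_sum (fun i => O_Q R[i] 0 (b_ i)%:Z))).
Proof.
split=> [a c1E _|b c1E _]; first exact: split_first.
exact: split_second.
Qed.
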